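(* For all $S>0$, for all $\Delta s>0$ (of the form $\Delta s=S/n$ with $n\ge 2$ an integer), and for any positive $\Delta t<2$, the Cayley splitting, i.e. the linear map on $\mathbb{R}^{2(n-1)}$ with matrix $$\boldsymbol{C} = \exp\left(\tfrac12 \Delta t\, \boldsymbol{B}\right)\,\mathrm{cay}(\Delta t\, \boldsymbol{A})\,\exp\left(\tfrac12 \Delta t\, \boldsymbol{B}\right),$$ is a stable numerical method for the infinite-dimensional linear Hamiltonian system $\partial_t u = p$, $\partial_t p = \partial_s^2 u - u$ on $[0,\infty)\times[0,S]$ with homogeneous Dirichlet boundary conditions $u(t,0)=u(t,S)=0$; that is, the set of matrix powers $\{\boldsymbol{C}^m : m\in\mathbb{N}\}$ is bounded.
   Context: Let $S>0$, let $n\ge2$ be an integer and let $\Delta s = S/n$ (spatial step size); $\Delta t>0$ is the time step size. $\boldsymbol{L}$ is the $(n-1)\times(n-1)$ discrete Dirichlet Laplacian: the symmetric tridiagonal matrix with diagonal entries $-2/\Delta s^2$ and entries $1/\Delta s^2$ on the first sub- and superdiagonal. With $\boldsymbol{I}$ the identity matrix, define the $2(n-1)\times 2(n-1)$ matrices $$\boldsymbol{A} = \begin{bmatrix} \boldsymbol{0} & \boldsymbol{I}\\ \boldsymbol{L} & \boldsymbol{0}\end{bmatrix},\qquad \boldsymbol{B}=\begin{bmatrix}\boldsymbol{0}&\boldsymbol{0}\\-\boldsymbol{I}&\boldsymbol{0}\end{bmatrix}.$$ The semidiscretization of the PDE by central differences on the uniform grid is $\dot{\boldsymbol{u}}=\boldsymbol{p}$,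 $\dot{\boldsymbol{p}}=\boldsymbol{L}\boldsymbol{u}-\boldsymbol{u}$. The Cayley transform of a matrix $\boldsymbol{X}$ with $\boldsymbol{I}-\frac12\boldsymbol{X}$ invertible is $\mathrm{cay}(\boldsymbol{X})=(\boldsymbol{I}-\frac12\boldsymbol{X})^{-1}(\boldsymbol{I}+\frac12\boldsymbol{X})$, and $\exp$ is the matrix exponential. A linear one-step method with matrix $\boldsymbol{C}$ is called stable if all its matrix powers are bounded, i.e. $\sup_{m\in\mathbb{N}}\|\boldsymbol{C}^m\|<\infty$. *)

(* Defs.v *)
From HB Require Import structures.
From mathcomp Require Import all_boot all_order all_algebra.
From mathcomp Require Import all_classical all_reals all_analysis.
Import Order.TTheory GRing.Theory Num.Theory.
Import numFieldNormedType.Exports.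

Set Implicit Arguments.
Unset Strict Implicit.
Unset Printing Implicit Defensive.

Local Open Scope classical_set_scope.
Local Open Scope ring_scope.

Section matrix_functions.
Variables (R : realType) (k : nat).
Implicit Types X C : 'M[R]_k.

(* The limit is taken in the normed topology of matrices, in which the series
   converges for every X. *)
Definition expmx X : 'M[R]_k :=
  lim (series (fun j : nat => (j`!%:R)^-1 *: X ^+ j) @ \oo).

Definition cay_defined X : bool := (1%:M - 2^-1 *: X) \in unitmx.

(* Meaningful only when [cay_defined X] holds: [invmx] is the identity on
   singular matrices. *)
Definition cay X : 'M[R]_k :=
  invmx (1%:M - 2^-1 *: X) *m (1%:M + 2^-1 *: X).

(* Boundedness is for the library's max-entry norm; all norms on the
   finite-dimensional space of matrices are equivalent. *)
Definition stable_method C : Prop :=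
  bounded_set [set C ^+ m | m in [set: nat]].

Definition cayley_splitting (dt : R) (A B : 'M[R]_k) : 'M[R]_k :=
  expmx ((2^-1 * dt) *: B) *m cay (dt *: A) *m expmx ((2^-1 * dt) *: B).

End matrix_functions.

Section semidiscretization.
Variable R : realType.

Definition dirichlet_laplacian (d : nat) (ds : R) : 'M[R]_d :=
  \matrix_(i, j)
    if i == j then - 2 / ds ^+ 2
    else if (i.+1 == j :> nat) || (j.+1 == i :> nat) then 1 / ds ^+ 2
    else 0.

(* [A + B] is the matrix of the central-difference semidiscretization
   u' = p, p' = L u - u, whose d unknowns are the values of u (resp. p) at the
   interior grid points ds, 2 ds, ..., d ds. *)
Definition A_mx (d : nat) (ds : R) : 'M[R]_(d + d) :=
  block_mx 0 1%:M (dirichlet_laplacian d ds) 0.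

Definition B_mx (d : nat) : 'M[R]_(d + d) :=
  block_mx 0 0 (- 1%:M) 0.

End semidiscretization.

Arguments B_mx R d : clear implicits.

(* Main.v *)
Require Import Defs.
From HB Require Import structures.
From mathcomp Require Import all_boot all_order all_algebra.
From mathcomp Require Import all_classical all_reals all_analysis.
From mathcomp Require Import zify ring lra.
Import Order.TTheory GRing.Theory Num.Theory.
Import numFieldNormedType.Exports.
Local Open Scope ring_scope.

(** The splitting matrix [C] preserves a positive definite quadratic form, so
    all its powers lie in a bounded set.

    Write [K] for the negative of the discrete Laplacian [L] and [h] for the
    time step. All blocks of [C] are functions of the one symmetric matrix [K],
    so [C] is a family of 2 x 2 matrices, one for each eigenvalue of [K]. Such
    a matrix has determinant 1 and equal diagonal entries, hence preserves a
    diagonal form, which after scaling is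

      (1 - h^2/4) u^T (I + K) u + p^T p.

    This is the energy of the semidiscrete wave equation with the potential
    part multiplied by [1 - h^2/4]. The bound [h < 2] makes that factor
    positive, and [K] is positive semidefinite for every grid size, so the form
    is at least [1 - h^2/4] times the Euclidean one.

    Diagonalization is not used; the invariance is a polynomial identity in
    [K] once the inverse in the Cayley transform has been cleared. Since
    [(I - hA/2)(I + hA/2)] is block diagonal with both blocks
    [r = I + (h^2/4) K] ([mul_cay_factors]), the product of [C] with
    [diag(r, r)] is a polynomial in [K] ([cleared_splittingE]). Its blocks are
    [a], [h I], [- h s], [a], where [s = (1 - h^2/4)(I + K)] is the upper block
    of the form, and invariance reduces to [a^2 + h^2 s = r^2]
    ([sqr_cay_denominator], [cleared_splitting_energy]).

    Positivity of [K] comes from the factorization [K = F^T F] with [F] a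
    difference quotient matrix ([dirichlet_laplacianE]). The same factorization
    shows that [r], and with it [I - hA/2], is invertible
    ([unitmx_add_gram]). *)

Set Implicit Arguments.
Unset Strict Implicit.
Unset Printing Implicit Defensive.

(** * Gram matrices *)

Definition gram (R : realType) (m n : nat) (F : 'M[R]_(m, n)) : 'M[R]_n :=
  F^T *m F.

Lemma tr_gram (R : realType) (m n : nat) (F : 'M[R]_(m, n)) :
  (gram F)^T = gram F.
Proof. by rewrite /gram trmx_mul trmxK. Qed.

Lemma gram_colE (R : realType) (n : nat) (v : 'cV[R]_n) :
  gram v 0 0 = \sum_i v i 0 ^+ 2.
Proof. by rewrite mxE; apply: eq_bigr => i _; rewrite mxE expr2. Qed.

Lemma gram_col_ge0 (R : realType) (n : nat) (v : 'cV[R]_n) :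
  0 <= gram v 0 0.
Proof. by rewrite gram_colE sumr_ge0 // => i _; apply: sqr_ge0. Qed.

Lemma gram_mulmx (R : realType) (m n p : nat) (F : 'M[R]_(m, n))
    (G : 'M[R]_(n, p)) : gram (F *m G) = G^T *m gram F *m G.
Proof. by rewrite /gram trmx_mul !mulmxA. Qed.

Lemma sqr_entry_le_gram (R : realType) (n : nat) (v : 'cV[R]_n) (i : 'I_n) :
  v i 0 ^+ 2 <= gram v 0 0.
Proof.
by rewrite gram_colE (bigD1 i) //= lerDl sumr_ge0 // => j _; apply: sqr_ge0.
Qed.

(** The kernel is trivial: if [u (I + c F^T F) = 0], pairing with [u] gives
    [|u|^2 + c |F u|^2 = 0]. *)
Lemma unitmx_add_gram (R : realType) (m n : nat) (F : 'M[R]_(m, n)) (c : R) :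
  0 <= c -> 1%:M + c *: gram F \in unitmx.
Proof.
move=> c_ge0; rewrite -row_free_unit; apply: inj_row_free => u u_ker.
have : (u *m (1%:M + c *: gram F) *m u^T) 0 0 = 0.
  by rewrite u_ker mul0mx mxE.
have -> : u *m (1%:M + c *: gram F) *m u^T
    = gram u^T + c *: gram (F *m u^T).
  rewrite gram_mulmx trmxK mulmxDr mulmxDl mulmx1 -scalemxAr -scalemxAl.
  by rewrite [in RHS]/gram trmxK.
rewrite mxE [X in _ + X]mxE => sum0.
have cg_ge0 : 0 <= c * gram (F *m u^T) 0 0 by rewrite mulr_ge0 // gram_col_ge0.
apply/rowP => j; rewrite [RHS]mxE; apply/eqP; rewrite -sqrf_eq0 eq_le sqr_ge0.
have := sqr_entry_le_gram u^T j; rewrite mxE => /le_trans -> //.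
lra.
Qed.

(** * Exponentials and invariant quadratic forms *)

(** The partial sums of the exponential series are constant from index 2 on. *)
Lemma expmx_nil2 (R : realType) (k : nat) (X : 'M[R]_k) :
  X *m X = 0 -> expmx X = 1%:M + X.
Proof.
move=> XX0; rewrite /expmx; apply: lim_near_cst; first exact: norm_hausdorff.
exists 2%N => // N /= N_ge2.
rewrite /series /= big_ltn ?(ltn_trans _ N_ge2) // big_ltn //.
rewrite fact0 expr0 invr1 scale1r expr1 scale1r big_nat big1 ?addr0 //.
move=> [|[|j]] // _.
by rewrite !exprS mulrA [X * X]XX0 mul0r scaler0.
Qed.

(** Each power [C^m] also preserves [M], so its [j]-th column [C^m e_j] has the
    same [M]-value as [e_j], namely [M j j]; coercivity turns this into a bound
    on the entries of that column which does not depend on [m]. *)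
Lemma invariant_form_stable (R : realType) (k : nat) (C M : 'M[R]_k) (a : R) :
    0 < a -> (forall v : 'cV_k, a * gram v 0 0 <= (v^T *m M *m v) 0 0) ->
    C^T *m M *m C = M ->
  stable_method C.
Proof.
move=> a_gt0 M_ge CMC.
have powM m : (C ^+ m)^T *m M *m C ^+ m = M.
  elim: m => [|m IHm]; first by rewrite expr0 trmx1 mul1mx mulmx1.
  by rewrite exprSr trmx_mul -2!mulmxA [M *m _]mulmxA [_ *m (M *m _ *m _)]mulmxA
             [_ *m (M *m _)]mulmxA IHm mulmxA.
pose b := a^-1 * \sum_j `|M j j|.
have entry_le m i j : (C ^+ m) i j ^+ 2 <= b.
  have := sqr_entry_le_gram (col j (C ^+ m)) i; rewrite mxE => /le_trans; apply.
  rewrite /b ler_pdivlMl //; apply: (le_trans (M_ge _)).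
  have -> : (col j (C ^+ m))^T *m M *m col j (C ^+ m)
      = row j (col j M).
    by rewrite -[in RHS](powM m) !colE !rowE trmx_mul trmx_delta !mulmxA.
  rewrite mxE mxE (le_trans (ler_norm _)) // (bigD1 j) //= lerDl.
  by rewrite sumr_ge0.
have b_ge0 : 0 <= b by rewrite mulr_ge0 ?invr_ge0 ?(ltW a_gt0) ?sumr_ge0.
exists (1 + b); split; first exact: num_real.
move=> r b_lt_r _ [m _ <-]; apply: le_trans (ltW b_lt_r).
rewrite [leLHS]/Num.Def.normr /= mx_normrE.
apply: bigmax_le => [|[i j] _ /=]; first by lra.
(* [b] bounds the squares, and [b <= (1 + b)^2] avoids a square root. *)
rewrite -(@ler_pXn2r _ 2) ?nnegrE ?real_normK ?num_real //; last by lra.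
by apply: (le_trans (entry_le m i j)); nra.
Qed.

(** * The Dirichlet Laplacian as a Gram matrix *)

(** Difference quotients on the [d.+1] cells of the grid; the zero boundary
    values account for the single nonzero entry in the first and in the last
    row. *)
Definition difference_mx (R : realType) (d : nat) (ds : R) : 'M[R]_(d.+1, d) :=
  \matrix_(i, j) (((i == j :> nat)%:R - (i == j.+1 :> nat)%:R) / ds).

Lemma sum_indicators (R : realType) (m a b : nat) : (a < m)%N ->
  \sum_(i < m) (i == a :> nat)%:R * (i == b :> nat)%:R = (a == b)%:R :> R.
Proof.
move=> a_lt; rewrite (bigD1 (Ordinal a_lt)) //= eqxx mul1r big1 ?addr0 //.
by move=> i /negPf; rewrite -val_eqE /= => ->; rewrite mul0r.
Qed.

Lemma dirichlet_laplacianE (R : realType) (d : nat) (ds : R) :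
  dirichlet_laplacian d ds = - gram (difference_mx d ds).
Proof.
apply/matrixP => j k; rewrite !mxE.
have -> : \sum_i (difference_mx d ds)^T j i * difference_mx d ds i k
  = ((j == k)%:R - (j == k.+1 :> nat)%:R - (j.+1 == k :> nat)%:R
     + (j == k)%:R) / ds ^+ 2.
  pose i_is (i : 'I_d.+1) (a : nat) : R := (i == a :> nat)%:R.
  rewrite (eq_bigr (fun i => (i_is i j * i_is i k - i_is i j * i_is i k.+1
      - i_is i j.+1 * i_is i k + i_is i j.+1 * i_is i k.+1) / ds ^+ 2)).
    rewrite -mulr_suml big_split /= !sumrB.
    by rewrite !sum_indicators ?ltnS ?(ltnW (ltn_ord j)) // ltnW.
  by move=> i _; rewrite !mxE -exprVn -!/(i_is _ _); ring.
rewrite -mulNr -val_eqE /= [k.+1 == _]eq_sym.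
have [->|_] := eqVneq (j : nat) k.
  by rewrite (ltn_eqF (ltnSn k)) (gtn_eqF (ltnSn k)) !subr0.
case: eqVneq => [j1_eq|_]; case: eqVneq => [j_eq|_] /=; first lia.
all: by rewrite !mulr0n !(subr0, addr0, sub0r, opprK, oppr0, mul0r).
Qed.

(** * The conserved energy *)

Section ConservedEnergy.
Variables (R : realType) (d : nat) (K : 'M[R]_d) (h : R).

Local Notation A := (block_mx 0 1%:M (- K) 0 : 'M[R]_(d + d)).
Local Notation B := (B_mx R d).

Definition kick_mx : 'M[R]_(d + d) := 1%:M + (2^-1 * h) *: B.

(** Its inverse is the common factor of the blocks of [cay (h *: A)]. *)
Definition cay_denominator_mx : 'M[R]_d := 1%:M + (h ^+ 2 / 4) *: K.

Local Notation N := (1%:M - 2^-1 *: (h *: A)).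
Local Notation P := (1%:M + 2^-1 *: (h *: A)).
Local Notation D := (block_mx cay_denominator_mx 0 0 cay_denominator_mx).

(** [B] has square zero. *)
Lemma expmx_kick : expmx ((2^-1 * h) *: B) = kick_mx.
Proof.
apply: expmx_nil2; rewrite -scalemxAl -scalemxAr /B_mx mulmx_block.
by rewrite !(mul0mx, mulmx0, addr0) block_mx_const !scaler0.
Qed.

(** An identity between polynomials of degree at most 2 in [K] is linear in
    [I], [K] and [K^2], so it can be checked entrywise; naming the square keeps
    its entries from being expanded into sums. *)
Ltac poly_in_K :=
  rewrite ?(mul0mx, mulmx0, mulmx1, mul1mx, scaler0, addr0, add0r, oppr0,
    mulmxDl, mulmxDr, mulmxN, mulNmx, scalerDr, scalerN, opprD, opprK,
    =^~ scalemxAl, =^~ scalemxAr, scalerA);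
  set K2 := K *m K; apply/matrixP => i j; rewrite !mxE; field.

Ltac block_poly_in_K :=
  rewrite ?(scalar_mx_block, scale_block_mx, opp_block_mx, add_block_mx,
    mulmx_block); congr block_mx; poly_in_K.

Lemma mul_cay_factors : N *m P = D.
Proof. by rewrite /cay_denominator_mx; block_poly_in_K. Qed.

Lemma cay_factor_comm : P *m D = D *m P.
Proof. by rewrite /cay_denominator_mx; block_poly_in_K. Qed.

Lemma kick_comm : kick_mx *m D = D *m kick_mx.
Proof. by rewrite /kick_mx /cay_denominator_mx /B_mx; block_poly_in_K. Qed.

(** The potential part of the conserved energy; the factor [1 - h^2/4] corrects
    the exact energy [I + K] for the splitting error. *)
Definition stiffness_mx : 'M[R]_d := (1 - h ^+ 2 / 4) *: (1%:M + K).

(** For an eigenvalue of [K], half the trace of the corresponding 2 x 2 block of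
    the splitting, multiplied by the eigenvalue of [cay_denominator_mx]. *)
Definition half_trace_mx : 'M[R]_d :=
  (1 - h ^+ 2 / 2) *: 1%:M - (h ^+ 2 / 4) *: K.

Definition energy_mx : 'M[R]_(d + d) := block_mx stiffness_mx 0 0 1%:M.

Definition cleared_splitting_mx : 'M[R]_(d + d) :=
  block_mx half_trace_mx (h *: 1%:M) (- h *: stiffness_mx) half_trace_mx.

(** As [P *m P] is [D] times the Cayley transform, the left-hand side is the
    splitting matrix multiplied by [D], which commutes with everything here. *)
Lemma cleared_splittingE : kick_mx *m (P *m P) *m kick_mx = cleared_splitting_mx.
Proof.
pose c : 'M[R]_d := 1%:M - (h ^+ 2 / 4) *: K.
have -> : P *m P = block_mx c (h *: 1%:M) (- h *: K) c.
  by rewrite /c; block_poly_in_K.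
have -> : kick_mx *m block_mx c (h *: 1%:M) (- h *: K) c
    = block_mx c (h *: 1%:M) (- h *: K - (h / 2) *: c) half_trace_mx.
  by rewrite /kick_mx /B_mx /half_trace_mx /c; block_poly_in_K.
rewrite /kick_mx /B_mx /cleared_splitting_mx /half_trace_mx /stiffness_mx /c.
by block_poly_in_K.
Qed.

Lemma stiffness_half_trace_comm :
  stiffness_mx *m half_trace_mx = half_trace_mx *m stiffness_mx.
Proof. by rewrite /stiffness_mx /half_trace_mx; poly_in_K. Qed.

Lemma stiffness_denominator_comm :
  stiffness_mx *m cay_denominator_mx = cay_denominator_mx *m stiffness_mx.
Proof. by rewrite /stiffness_mx /cay_denominator_mx; poly_in_K. Qed.

(** The determinant of the splitting is 1 in each mode. *)
Lemma sqr_cay_denominator :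
  half_trace_mx *m half_trace_mx + h ^+ 2 *: stiffness_mx
    = cay_denominator_mx *m cay_denominator_mx.
Proof. by rewrite /stiffness_mx /half_trace_mx /cay_denominator_mx; poly_in_K. Qed.

Hypothesis K_sym : K^T = K.

(** With blocks [a], [h I], [- h s], [a] and the form [diag(s, I)], the
    off-diagonal blocks cancel because [s] and [a] commute, and the diagonal
    ones are [s (a^2 + h^2 s)] and [a^2 + h^2 s]. *)
Lemma cleared_splitting_energy :
  cleared_splitting_mx^T *m energy_mx *m cleared_splitting_mx
    = D^T *m energy_mx *m D.
Proof.
have half_trace_sym : half_trace_mx^T = half_trace_mx.
  by rewrite /half_trace_mx linearB !linearZ /= trmx1 K_sym.
have stiffness_sym : stiffness_mx^T = stiffness_mx.
  by rewrite /stiffness_mx linearZ linearD /= trmx1 K_sym.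
have denominator_sym : cay_denominator_mx^T = cay_denominator_mx.
  by rewrite /cay_denominator_mx linearD linearZ /= trmx1 K_sym.
rewrite /cleared_splitting_mx /energy_mx.
move: stiffness_half_trace_comm stiffness_denominator_comm sqr_cay_denominator.
move: stiffness_mx half_trace_mx cay_denominator_mx half_trace_sym stiffness_sym
  denominator_sym => s a r aT sT rT sa sr aa_rr.
rewrite !tr_block_mx !linearZ /= !trmx1 !trmx0 aT sT rT !mulmx_block.
rewrite !(mul0mx, mulmx0, mulmx1, mul1mx, addr0, add0r).
rewrite -!(scalemxAl, scalemxAr) !mul1mx !mulmx1 !scalerA.
congr block_mx.
- rewrite -sa -sr -!mulmxA -aa_rr mulmxDr -scalemxAr.
  by rewrite mulrNN -expr2.
- by rewrite scaleNr sa subrr.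
- by rewrite scaleNr sa subrr.
- by rewrite -aa_rr addrC -expr2.
Qed.

Hypothesis denominator_unit : cay_denominator_mx \in unitmx.

Lemma denominator_diag_unit : D \in unitmx.
Proof.
pose J := invmx cay_denominator_mx.
suff DJ : D *m block_mx J 0 0 J = 1%:M by case: (mulmx1_unit DJ).
by rewrite mulmx_block !(mul0mx, mulmx0, addr0, add0r) mulmxV // scalar_mx_block.
Qed.

(** [I - hA/2] is a factor of the invertible [D]. *)
Lemma cay_wave_defined : cay_defined (h *: A).
Proof.
by have := denominator_diag_unit; rewrite -mul_cay_factors unitmx_mul => /andP[].
Qed.

Lemma cayley_splitting_energy (C := cayley_splitting h A B) :
  C^T *m energy_mx *m C = energy_mx.
Proof.
have D_unit := denominator_diag_unit.
have CD : C *m D = cleared_splitting_mx.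
  rewrite /C /cayley_splitting /cay expmx_kick -cleared_splittingE -!mulmxA.
  rewrite kick_comm [P *m (D *m _)]mulmxA cay_factor_comm.
  by rewrite -mul_cay_factors -!mulmxA (mulKmx cay_wave_defined).
have -> : C = cleared_splitting_mx *m invmx D by rewrite -CD mulmxK.
rewrite trmx_mul -2!mulmxA [energy_mx *m _]mulmxA.
rewrite [cleared_splitting_mx^T *m _]mulmxA [cleared_splitting_mx^T *m _]mulmxA.
rewrite cleared_splitting_energy !mulmxA -trmx_mul mulmxV // trmx1 mul1mx.
by rewrite -mulmxA mulmxV // mulmx1.
Qed.

End ConservedEnergy.

(** With [v = (u, p)] and [K = F^T F], the energy is
    [(1 - h^2/4) (|u|^2 + |F u|^2) + |p|^2]. *)
Lemma energy_ge (R : realType) (m d : nat) (F : 'M[R]_(m, d)) (h : R)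
    (v : 'cV_(d + d)) : h ^+ 2 <= 4 ->
  (1 - h ^+ 2 / 4) * gram v 0 0 <= (v^T *m energy_mx (gram F) h *m v) 0 0.
Proof.
move=> h2_le4; rewrite -(vsubmxK v).
move: (usubmx v) (dsubmx v) => u p.
have -> : gram (col_mx u p) = gram u + gram p.
  by rewrite /gram tr_col_mx mul_row_col.
have -> : (col_mx u p)^T *m energy_mx (gram F) h *m col_mx u p
    = (1 - h ^+ 2 / 4) *: (gram u + gram (F *m u)) + gram p.
  rewrite tr_col_mx mul_row_block !(mulmx0, addr0, add0r) mul_row_col mulmx1.
  rewrite gram_mulmx -scalemxAr -scalemxAl mulmxDr mulmx1 mulmxDl.
  by rewrite /gram !mulmxA.
rewrite !mxE -!/(gram _).
have := gram_col_ge0 p; have := gram_col_ge0 (F *m u); rewrite !mxE; nra.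
Qed.

Theorem proposition3p14 (R : realType) (S ds dt : R) (n : nat)
    (S_gt0 : 0 < S) (n_ge2 : (2 <= n)%N) (ds_def : ds = S / n%:R)
    (dt_gt0 : 0 < dt) (dt_lt2 : dt < 2) :
  cay_defined (dt *: A_mx n.-1 ds) /\
  stable_method (cayley_splitting dt (A_mx n.-1 ds) (B_mx R n.-1)).
Proof.
pose K := gram (difference_mx n.-1 ds).
have denominator_unit : cay_denominator_mx K dt \in unitmx.
  by apply: unitmx_add_gram; rewrite divr_ge0 // sqr_ge0.
rewrite /A_mx dirichlet_laplacianE -/K; split; first exact: cay_wave_defined.
have dt2_lt4 : dt ^+ 2 < 4 by nra.
apply: (@invariant_form_stable _ _ _ (energy_mx K dt) (1 - dt ^+ 2 / 4)).
- by lra.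
- by move=> v; apply: energy_ge; apply: ltW.
- by apply: cayley_splitting_energy => //; apply: tr_gram.
Qed.
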